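(* Let $p=p(n)\in[0,1]$ satisfy $p n/(\log_2 n)^2\to\infty$ as $n\to\infty$. Then asymptotically almost surely (i.e. with probability tending to $1$ as $n\to\infty$), $$\chi'_{\rm ccf}(\mathbb{G}_{n,p})\ge\log_2(pn)-2\log_2\log_2 n\quad\text{and}\quad\chi'_{\rm ocf}(\mathbb{G}_{n,p})\ge\log_2(pn)-2\log_2\log_2 n.$$
   Context: $\mathbb{G}_{n,p}$ is the binomial random graph on vertex set $[n]$ in which each pair of vertices is joined independently with probability $p$. For an edge $e=uv$ of a graph $G=(V,E)$, $E[e]$ is the set of edges incident with $u$ or $v$ and $E(e)=E[e]\setminus\{e\}$. An edge colouring is closed conflict-free if for every edge $e$ some colour is assigned to exactly one edge of $E[e]$, and open conflict-free if for every edge $e$ with $E(e)\ne\emptyset$ some colour is assigned to exactly one edge of $E(e)$. $\chi'_{\rm ccf}(G)$ and $\chi'_{\rm ocf}(G)$ denote the minimum numbers of colours in such colourings, respectively. *)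

(* Defs.v *)
From mathcomp Require Import all_boot all_order all_algebra.
From mathcomp Require Import all_classical all_reals all_analysis.
Set Implicit Arguments. Unset Strict Implicit. Unset Printing Implicit Defensive.
Import Order.TTheory GRing.Theory Num.Theory.
Local Open Scope ring_scope.

Definition pairs (n : nat) : {set {set 'I_n}} := [set e : {set 'I_n} | #|e| == 2%N].

Definition is_graph (n : nat) (G : {set {set 'I_n}}) : bool := G \subset pairs n.

Definition closed_nbhd (n : nat) (G : {set {set 'I_n}}) (e : {set 'I_n}) :
  {set {set 'I_n}} := [set f in G | f :&: e != finset.set0].

Definition open_nbhd (n : nat) (G : {set {set 'I_n}}) (e : {set 'I_n}) :
  {set {set 'I_n}} := closed_nbhd G e :\ e.

Definition uses_colours (n : nat) (G : {set {set 'I_n}}) (c : {set 'I_n} -> nat)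
  (k : nat) : Prop := forall e, e \in G -> (c e < k)%N.

Definition has_unique_colour (n : nat) (c : {set 'I_n} -> nat)
  (S : {set {set 'I_n}}) : Prop :=
  exists i : nat, #|[set f in S | c f == i]| = 1%N.

Definition closed_cf (n : nat) (G : {set {set 'I_n}}) (c : {set 'I_n} -> nat) : Prop :=
  forall e, e \in G -> has_unique_colour c (closed_nbhd G e).

Definition open_cf (n : nat) (G : {set {set 'I_n}}) (c : {set 'I_n} -> nat) : Prop :=
  forall e, e \in G -> open_nbhd G e != finset.set0 -> has_unique_colour c (open_nbhd G e).

(* Minimum number of colours of a colouring with property P.  The minimum is
   taken over k <= #|pairs n|; since colouring every edge with its own colour
   is both closed and open conflict-free, the true minimum is always at most
   #|G| <= #|pairs n|, so this cap does not change the value. *)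
Definition min_colours (n : nat) (G : {set {set 'I_n}})
  (P : {set {set 'I_n}} -> ({set 'I_n} -> nat) -> Prop) : nat :=
  \big[minn/#|pairs n|]_(k < (#|pairs n|).+1 |
        `[< exists c : {set 'I_n} -> nat, uses_colours G c k /\ P G c >]) (k : nat).

Definition chi_ccf (n : nat) (G : {set {set 'I_n}}) : nat := min_colours G (@closed_cf n).
Definition chi_ocf (n : nat) (G : {set {set 'I_n}}) : nat := min_colours G (@open_cf n).

Definition Gnp_prob (R : realType) (n : nat) (p : R) (A : pred {set {set 'I_n}}) : R :=
  \sum_(G : {set {set 'I_n}} | is_graph G && A G)
     p ^+ #|G| * (1 - p) ^+ (#|pairs n| - #|G|).

Definition log2 (R : realType) (x : R) : R := ln x / ln 2.

Arguments Gnp_prob {R} n p A.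

(* Main.v *)
(* Call A(v) the set of colours seen at a vertex v.  With k colours there are at
   most 2^k such sets, so some set S of at least n / 2^k vertices shares a common
   A(v).  For an edge e inside S, a colour other than that of e is seen at both
   ends or at none; conflict-freeness then forces e to be the only edge of its
   colour at one of its ends.  Hence e is determined by that end and its colour,
   and S spans at most k|S| edges.

   If k < log2(pn) - 2 log2(log2 n), i.e. 2^k (log2 n)^2 < pn, then
   p|S| > (log2 n)^2 and 2^e(S) <= 2^(k|S|) <= n^|S|.  By Markov's inequality for
   2^(-e(S)), a given set S of size s satisfies the latter with probability at most
   n^s (1 - p/2)^(s choose 2) <= q^s, where q = n exp(- ((log2 n)^2 - 1) / 4).
   Summing over nonempty S gives at most (1 + q)^n - 1 <= exp(nq) - 1 -> 0. *)

Require Import Defs.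
From mathcomp Require Import all_boot all_order all_algebra.
From mathcomp Require Import all_classical all_reals all_analysis.
From mathcomp Require Import lra ring.
Import Order.TTheory GRing.Theory Num.Theory.
Import numFieldNormedType.Exports.
Local Open Scope ring_scope.

(** * Vertex sets spanning few edges in conflict-free coloured graphs *)

Section Colouring.

Local Open Scope nat_scope.

Context {n : nat}.
Implicit Types (G N : {set {set 'I_n}}) (c : {set 'I_n} -> nat) (e f g : {set 'I_n}).

Definition induced_edges G (S : {set 'I_n}) : {set {set 'I_n}} :=
  [set e in G | e \subset S].

Definition colours_at G c (k : nat) (v : 'I_n) : {set 'I_k} :=
  [set i : 'I_k | [exists f in G, (v \in f) && (c f == i)]].

Lemma unique_colour_edge c N : has_unique_colour c N ->
  exists2 f, f \in N & forall g, g \in N -> c g = c f -> g = f.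
Proof.
move=> [i] /eqP /cards1P [f fE].
have : f \in [set f in N | c f == i] by rewrite fE inE.
rewrite inE => /andP [fN /eqP cf]; exists f => // g gN cg.
apply/set1P; rewrite -fE inE gN; apply/eqP; congruence.
Qed.

Lemma in_open_nbhd G e f x :
  f \in G -> x \in e -> x \in f -> f != e -> f \in open_nbhd G e.
Proof.
move=> fG xe xf fe; rewrite !inE fe fG /=.
by apply/finset.set0Pn; exists x; rewrite inE xf xe.
Qed.

(* [N] stands for [E[e]] or [E(e)].  Its uniquely coloured edge [f] must have colour
   [c e]; if [f = e] then both ends of [e] work, otherwise the end not on [f] does. *)
Lemma endpoint_of_own_colour G N c k e x y : is_graph G -> uses_colours G c k ->
  e \in G -> x != y -> e = [set x; y] ->
  open_nbhd G e \subset N -> N \subset closed_nbhd G e ->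
  N = finset.set0 \/ has_unique_colour c N ->
  colours_at G c k x = colours_at G c k y ->
  exists2 z, z \in e & forall g, g \in G -> z \in g -> c g = c e -> g = e.
Proof.
move=> grG ck eG xy eE oN Nc hN hcol.
have xe : x \in e by rewrite eE !inE eqxx.
have ye : y \in e by rewrite eE !inE eqxx orbT.
have inN g z : g \in G -> z \in e -> z \in g -> g != e -> g \in N.
  by move=> gG ze zg ge; apply: (fintype.subsetP oN); apply: (@in_open_nbhd G e g z).
case: hN => [N0|/unique_colour_edge [f fN funiq]].
  (* With [N] empty, [e] is the only edge at [x]. *)
  exists x => // g gG xg _; apply/eqP/negP => /negP /(inN _ _ gG xe xg).
  by rewrite N0 inE.
have [fE|fe] := eqVneq f e.
  exists x => // g gG xg cg; apply/eqP; case: eqVneq => // ge.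
  by case/eqP: (ge); rewrite -fE; apply: funiq; [exact: (inN g x)|rewrite fE].
have /andP [fG fI] : (f \in G) && (f :&: e != finset.set0).
  by have := fintype.subsetP Nc _ fN; rewrite inE.
have not_both : ~~ ((x \in f) && (y \in f)).
  apply: contra fe => /andP [xf yf]; rewrite eq_sym eqEcard.
  have := fintype.subsetP grG _ fG; have := fintype.subsetP grG _ eG.
  rewrite !inE => /eqP -> /eqP ->; rewrite leqnn andbT eE.
  by apply/fintype.subsetP => z /set2P [] ->.
have [u [v [ue ve uf vf cuv]]] : exists u v, [/\ u \in e, v \in e,
    u \in f, v \notin f & colours_at G c k u = colours_at G c k v].
  have /finset.set0Pn [z] := fI; rewrite inE => /andP [zf].
  rewrite {1}eE => /set2P [] zE; rewrite zE in zf.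
    by exists x, y; split => //; move: not_both; rewrite zf.
  by exists y, x; split => //; move: not_both; rewrite zf andbT.
have [cfe|cfe] := eqVneq (c f) (c e).
  exists v => // g gG vg cg; apply: contraNeq vf => ge.
  by rewrite -(funiq g) //; [exact: (inN g v)|congruence].
(* When [c f] differs from [c e], it is seen at [u], hence also at [v], on some edge [g] other than
   [e]. Uniqueness gives [g = f], contradicting [v \notin f]. *)
have : Ordinal (ck _ fG) \in colours_at G c k u.
  by rewrite inE; apply/existsP; exists f; rewrite fG uf /=.
rewrite cuv inE => /existsP [g /and3P [gG vg /eqP /= cg]].
have ge : g != e by apply: contraNneq cfe => <-; rewrite cg.
by move: vf; rewrite -(funiq g) ?vg //; exact: (inN g v).
Qed.

Lemma card_induced_le G c k (S : {set 'I_n}) : uses_colours G c k ->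
  (forall e, e \in induced_edges G S ->
     exists2 z, z \in e & forall g, g \in G -> z \in g -> c g = c e -> g = e) ->
  #|induced_edges G S| <= k * #|S|.
Proof.
move=> ck own.
pose D := finset.setX S [set: 'I_k].
(* The last conjunct makes the pick unambiguous. The default value is harmless: the image of [h]
   only has to contain the induced edges. *)
pose h (t : 'I_n * 'I_k) : {set 'I_n} :=
  odflt finset.set0 [pick e in induced_edges G S | (t.1 \in e) && (c e == t.2)
     && [forall g in G, (t.1 \in g) && (c g == c e) ==> (g == e)]].
have -> : k * #|S| = #|D| by rewrite cardsX cardsT card_ord mulnC.
apply: leq_trans (leq_imset_card h (mem D)); apply: subset_leq_card.
apply/fintype.subsetP => e eI; have [z ze zown] := own _ eI.
have /andP [eG eS] : (e \in G) && (e \subset S) by move: eI; rewrite inE.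
apply/imsetP; exists (z, Ordinal (ck _ eG)).
  by rewrite !inE (fintype.subsetP eS).
rewrite /h; case: pickP => [e' /=|/(_ e) /=].
  move=> /and3P [_ /andP [ze' /eqP ce'] /forall_inP H].
  by apply/eqP; apply: (implyP (H e eG)); rewrite ze ce' eqxx.
rewrite eI ze eqxx /= => /negP []; apply/forall_inP => g gG.
by apply/implyP => /andP [zg /eqP cg]; apply/eqP; apply: zown.
Qed.

(** Pigeonhole: a largest fibre has at least average size. The point [t0] makes [T] inhabited, so
    that a maximum exists. *)
Lemma large_fibre (T : finType) (h : 'I_n -> T) (t0 : T) :
  exists t, n <= #|T| * #|[set v | h v == t]|.
Proof.
pose F t := #|[set v | h v == t]|.
exists [arg max_(t > t0) F t]; case: arg_maxnP => // t _ tmax.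
rewrite -[leqLHS](card_ord n) -[leqLHS]sum1_card (partition_big h predT) //=.
rewrite -sum_nat_const.
apply: leq_sum => t' _; rewrite sum1dep_card; exact: tmax.
Qed.

(** Treats closed and open colourings at once. The alternative [N e = finset.set0] covers edges on
    which the open condition is vacuous. *)
Lemma sparse_class_of_nbhds G c k (N : {set 'I_n} -> {set {set 'I_n}}) :
  is_graph G -> uses_colours G c k ->
  (forall e, open_nbhd G e \subset N e /\ N e \subset closed_nbhd G e) ->
  (forall e, e \in G -> N e = finset.set0 \/ has_unique_colour c (N e)) ->
  exists S : {set 'I_n}, n <= 2 ^ k * #|S| /\ #|induced_edges G S| <= k * #|S|.
Proof.
move=> grG ck hN hcf.
have [A] := @large_fibre {set 'I_k} (colours_at G c k) finset.set0.
have -> : #|{set 'I_k}| = 2 ^ k.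
  by rewrite -cardsT -powersetT card_powerset cardsT card_ord.
set S := finset.finset _ => leS; exists S; split => //.
apply: (@card_induced_le G c) => // e; rewrite inE => /andP [eG eS].
have := fintype.subsetP grG _ eG; rewrite inE => /cards2P [x [y [xy eE]]].
apply: (endpoint_of_own_colour G (N e) c k e x y grG ck eG xy eE
         (hN e).1 (hN e).2 (hcf e eG)).
have inS z : z \in e -> colours_at G c k z = A.
  by move/(fintype.subsetP eS); rewrite inE => /eqP.
by rewrite !inS // eE !inE eqxx ?orbT.
Qed.

Lemma closed_cf_sparse_class G c k :
  is_graph G -> uses_colours G c k -> closed_cf G c ->
  exists S : {set 'I_n}, n <= 2 ^ k * #|S| /\ #|induced_edges G S| <= k * #|S|.
Proof.
move=> grG ck hcf; apply: (@sparse_class_of_nbhds G c k (closed_nbhd G)) => // e.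
  by split; rewrite ?subD1set.
by right; exact: hcf.
Qed.

Lemma open_cf_sparse_class G c k :
  is_graph G -> uses_colours G c k -> open_cf G c ->
  exists S : {set 'I_n}, n <= 2 ^ k * #|S| /\ #|induced_edges G S| <= k * #|S|.
Proof.
move=> grG ck hcf; apply: (@sparse_class_of_nbhds G c k (open_nbhd G)) => // e.
  by split; rewrite ?subD1set.
have [->|e0] := eqVneq (open_nbhd G e) finset.set0; first by left.
by right; exact: hcf.
Qed.

End Colouring.

(** * Edge weights, Markov's inequality and the union bound for the random graph *)

Section RandomGraph.

Context {R : realType} {n : nat}.
Implicit Types (G : {set {set 'I_n}}) (S : {set 'I_n}) (p q a : R).

Definition graph_weight p G : R := p ^+ #|G| * (1 - p) ^+ (#|pairs n| - #|G|).

Lemma graph_weight_ge0 p G : 0 <= p <= 1 -> 0 <= graph_weight p G.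
Proof. by case/andP=> p0 p1; rewrite mulr_ge0 ?exprn_ge0 ?subr_ge0. Qed.

(** Independence of the pairs: the expectation of a product over edges factors. *)
Lemma sum_graph_weight p (w : {set 'I_n} -> R) :
  \sum_(G | is_graph G) graph_weight p G * \prod_(e in G) w e
    = \prod_(e in pairs n) (p * w e + (1 - p)).
Proof.
rewrite [RHS]big_mkcond /=.
(* Off [pairs n] the factor 1 is split as [0 + 1], so that expanding over all families of sets kills
   those that are not graphs. *)
under [RHS]eq_bigr => e _ do
  (rewrite (_ : (if _ then _ else _) =
    (if e \in pairs n then p * w e else 0) +
    (if e \in pairs n then 1 - p else 1)); last by case: ifP => _; rewrite ?add0r).
rewrite bigA_distr big_mkcond /=; apply: eq_bigr => G _.
case: ifPn => [grG|/fintype.subsetPn [e eG eP]]; last first.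
  by rewrite (bigD1 e) //= eG (negbTE eP) mul0r.
rewrite [RHS](bigID (mem G)) /= /graph_weight mulrAC; congr (_ * _).
  rewrite -prodr_const -big_split /=; apply: eq_bigr => e eG.
  by rewrite eG (fintype.subsetP grG).
have <- : #|pairs n :\: G| = (#|pairs n| - #|G|)%N.
  by rewrite cardsD (finset.setIidPr grG).
rewrite -prodr_const [LHS]big_mkcond [RHS]big_mkcond /=.
by apply: eq_bigr => e _; rewrite !inE; case: (e \in G) => //=; case: ifP.
Qed.

Lemma sum_graph_weight1 p : \sum_(G | is_graph G) graph_weight p G = 1.
Proof.
transitivity (\prod_(e in pairs n) (p * 1 + (1 - p))).
  rewrite -(sum_graph_weight p (fun=> 1)).
  by apply: eq_bigr => G _; rewrite big1 // mulr1.
by rewrite big1 // => e _; rewrite mulr1 addrC subrK.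
Qed.

Lemma Gnp_probC p (A : pred {set {set 'I_n}}) :
  Gnp_prob n p A = 1 - Gnp_prob n p (predC A).
Proof.
apply/eqP; rewrite -(sum_graph_weight1 p) eq_sym subr_eq eq_sym; apply/eqP.
by rewrite [RHS](bigID A).
Qed.

Lemma card_pairs_subset S : #|[set e in pairs n | e \subset S]| = 'C(#|S|, 2).
Proof. by rewrite -cards_draws; apply: eq_card => e; rewrite !inE andbC. Qed.

(** On the event, n^|S| 2^(-e(S)) is at least 1. In the expectation of 2^(-e(S)) each pair inside
    [S] contributes [p / 2 + (1 - p)]. *)
Lemma Gnp_prob_sparse p S : 0 <= p <= 1 ->
  Gnp_prob n p (fun G => 2 ^ #|induced_edges G S| <= n ^ #|S|)%N
    <= n%:R ^+ #|S| * (1 - p / 2) ^+ 'C(#|S|, 2).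
Proof.
move=> p01; pose w (e : {set 'I_n}) : R := if e \subset S then 2^-1 else 1.
have wE G : \prod_(e in G) w e = 2^-1 ^+ #|induced_edges G S|.
  rewrite -prodr_const -big_mkcondr /=.
  by apply: eq_bigl => e; rewrite inE.
have -> : (1 - p / 2) ^+ 'C(#|S|, 2) = \prod_(e in pairs n) (p * w e + (1 - p)).
  rewrite -card_pairs_subset -prodr_const.
  rewrite (eq_bigl (fun e : {set 'I_n} => (e \in pairs n) && (e \subset S))).
    rewrite big_mkcondr /=; apply: eq_bigr => e _.
    by rewrite /w; case: ifP => _; [field|ring].
  by move=> e; rewrite inE.
rewrite -sum_graph_weight mulr_sumr /Gnp_prob big_mkcondr /=; apply: ler_sum => G _.
rewrite wE -/(graph_weight p G) mulrCA; case: ifPn => [le2n|_]; last first.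
  by apply: mulr_ge0; rewrite ?graph_weight_ge0 // mulr_ge0 ?exprn_ge0 ?invr_ge0.
rewrite ler_peMr ?graph_weight_ge0 // exprVn ler_pdivlMr ?exprn_gt0 // mul1r.
by rewrite -!natrX ler_nat.
Qed.

Lemma sum_subsets q : \sum_(S : {set 'I_n}) q ^+ #|S| = (1 + q) ^+ n.
Proof.
rewrite -[in RHS](card_ord n) -prodr_const; under [RHS]eq_bigr do rewrite addrC.
rewrite bigA_distr; apply: eq_bigr => S _.
by rewrite -prodr_const big_mkcond.
Qed.

(* This is [1 - x <= exp(-x)] at [x = p / 2], together with [a - 1 <= p * (s - 1)]. *)
Lemma sparse_bound p a (s : nat) : 0 <= p <= 1 -> a < p * s%:R ->
  (n%:R ^+ s * (1 - p / 2) ^+ 'C(s, 2) : R) <= (n%:R * expR (- (a - 1) / 4)) ^+ s.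
Proof.
move=> /andP [p0 p1] ha; rewrite exprMn ler_wpM2l ?exprn_ge0 //.
have le_exp : 1 - p / 2 <= expR (- (p / 2)) by exact: expR_ge1Dx.
apply: (@le_trans _ _ (expR (- (p / 2)) ^+ 'C(s, 2))).
  by rewrite lerXn2r ?nnegrE ?expR_ge0 //; lra.
rewrite -!expRM_natl ler_expR.
case: s ha => [|s] ha; first by rewrite bin0n !mul0r.
have : (2 * 'C(s.+1, 2)%:R : R) = s.+1%:R * s%:R.
  by rewrite -!natrM -mul_bin_diag bin1.
set C : R := _%:R => CE; rewrite -natr1 in ha CE *.
have s0 : 0 <= s%:R :> R by [].
(* This product is four times the difference of the two exponents. *)
have : 0 <= (s%:R + 1) * (p * s%:R - (a - 1)) :> R by apply: mulr_ge0; lra.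
nra.
Qed.

Lemma Gnp_prob_ge p a (A : pred {set {set 'I_n}}) : 0 <= p <= 1 -> 0 <= a ->
  (forall G, is_graph G -> ~~ A G -> exists S : {set 'I_n},
     a < p * #|S|%:R /\ (2 ^ #|induced_edges G S| <= n ^ #|S|)%N) ->
  2 - expR (n%:R * (n%:R * expR (- (a - 1) / 4))) <= Gnp_prob n p A.
Proof.
move=> p01 a0 hA; set q := n%:R * expR _; have q0 : 0 <= q by rewrite mulr_ge0 ?expR_ge0.
rewrite Gnp_probC; suff : Gnp_prob n p (predC A) <= (1 + q) ^+ n - 1.
  have : (1 + q) ^+ n <= expR (n%:R * q).
    by rewrite expRM_natl lerXn2r ?nnegrE ?expR_ge0 ?addr_ge0 // expR_ge1Dx.
  lra.
rewrite -sum_subsets (bigD1 finset.set0) //= cards0 expr0 [leRHS]addrC addKr.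
pose E S G := (2 ^ #|induced_edges G S| <= n ^ #|S|)%N.
have ub : Gnp_prob n p (predC A) <=
    \sum_(S : {set 'I_n} | a < p * #|S|%:R) Gnp_prob n p (E S).
  rewrite /Gnp_prob; under [leRHS]eq_bigr do rewrite big_mkcondr.
  rewrite exchange_big /= big_mkcondr /=; apply: ler_sum => G grG.
  rewrite -/(graph_weight p G).
  have w0 := graph_weight_ge0 p G p01.
  case: ifPn => [/(hA G grG) [S [aS ES]]|_]; last first.
    by apply: sumr_ge0 => S _; case: ifP.
  rewrite (bigD1 S) //= /E ES lerDl.
  by apply: sumr_ge0 => S' _; case: ifP.
apply: (le_trans ub).
rewrite [leRHS](bigID (fun S : {set 'I_n} => a < p * #|S|%:R)) /=.
apply: ler_wpDr; first by apply: sumr_ge0 => S _; rewrite exprn_ge0.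
(* As [0 <= a], the empty set fails the size condition, so removing it loses no term of the union
   bound. *)
rewrite [leRHS](eq_bigl (fun S : {set 'I_n} => a < p * #|S|%:R)); last first.
  move=> S; rewrite andbC; case: ltP => //= aS.
  by apply: contraTneq aS => ->; rewrite cards0 mulr0 -leNgt.
apply: ler_sum => S aS; apply: le_trans (Gnp_prob_sparse p S p01) _.
exact: sparse_bound.
Qed.

End RandomGraph.

(** * From few colours to a sparse set, numerical estimates and the limit *)

Lemma Gnp_prob_le1 (R : realType) (n : nat) (p : R) (A : pred {set {set 'I_n}}) :
  0 <= p <= 1 -> Gnp_prob n p A <= 1.
Proof.
move=> p01; rewrite Gnp_probC gerBl; apply: sumr_ge0 => G _.
exact: graph_weight_ge0.
Qed.

(** The first hypothesis handles the starting value of the capped minimum, the second its other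
    entries. *)
Lemma min_colours_ge (R : realType) (n : nat) (G : {set {set 'I_n}})
  (P : {set {set 'I_n}} -> ({set 'I_n} -> nat) -> Prop) (b : R) :
  b <= #|pairs n|%:R ->
  (forall k c, uses_colours G c k -> P G c -> b <= k%:R) ->
  b <= (min_colours G P)%:R.
Proof.
move=> bM bk; rewrite /min_colours.
apply: (big_ind (fun m : nat => b <= m%:R)) => // [x y bx b_y|k].
  by rewrite /minn; case: ifP.
by move=> /asboolP [c [ck Pc]]; exact: (bk k c).
Qed.

Lemma pow2_of_lt_log2 (R : realType) (k : nat) (x y : R) : 0 < x -> 0 < y ->
  k%:R < log2 x - 2 * log2 y -> 2 ^+ k * y ^+ 2 < x.
Proof.
move=> x0 y0; rewrite /log2.
have l0 : 0 < ln 2 :> R by rewrite ln_gt0 ?ltr1n.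
rewrite mulrA -mulrBl ltr_pdivlMr // ltrBrDr => lt_ln.
by rewrite -ltr_expR expRD !expRM_natl !lnK ?posrE in lt_ln.
Qed.

Lemma card_pairs_ge (n : nat) : (3 <= n)%N -> (n <= #|pairs n|)%N.
Proof.
move=> n3; have -> : #|pairs n| = 'C(n, 2).
  rewrite -[n in RHS]card_ord -cardsT -cards_draws.
  by apply: eq_card => e; rewrite !inE finset.subsetT.
rewrite -(@leq_pmul2l 2) // -mul_bin_diag bin1 mulnC leq_mul2l.
by case: n n3 => // n; rewrite ltnS => ->; rewrite orbT.
Qed.

Lemma few_colours_sparse_set (R : realType) (n : nat) (p L : R)
  (G : {set {set 'I_n}}) : 0 <= p <= 1 -> 0 < p * n%:R -> 1 <= L -> (3 <= n)%N ->
  is_graph G ->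
  ~~ ((log2 (p * n%:R) - 2 * log2 L <= (chi_ccf G)%:R)
     && (log2 (p * n%:R) - 2 * log2 L <= (chi_ocf G)%:R)) ->
  exists S : {set 'I_n}, L ^+ 2 < p * #|S|%:R
     /\ (2 ^ #|induced_edges G S| <= n ^ #|S|)%N.
Proof.
move=> /andP [p0 p1] pn0 L1 n3 grG; set b := _ - _ => bad.
have L0 : 0 < L by lra.
have pow_lt k : k%:R < b -> 2 ^+ k * L ^+ 2 < p * n%:R by exact: pow2_of_lt_log2.
have L2 : 1 <= L ^+ 2 by rewrite exprn_ege1.
have pn : p * n%:R <= n%:R by rewrite ler_piMl.
have pow_le k : k%:R < b -> (2 ^ k <= n)%N.
  move=> /pow_lt klt; rewrite -(ler_nat R) natrX.
  apply: le_trans pn; apply: le_trans (ltW klt); by rewrite ler_peMr ?exprn_ge0.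
(* Were M = [#|pairs n|] below [b], then 2^M <= n <= M, which is absurd. *)
have bM : b <= #|pairs n|%:R.
  rewrite leNgt; apply/negP => /pow_le; rewrite leqNgt => /negP; apply.
  by apply: leq_ltn_trans (card_pairs_ge n n3) _; exact: ltn_expl.
suff [k [S [kb nS eS]]] : exists k (S : {set 'I_n}), [/\ k%:R < b,
    (n <= 2 ^ k * #|S|)%N & (#|induced_edges G S| <= k * #|S|)%N].
  exists S; split.
    have k0 : 0 < 2 ^+ k :> R by rewrite exprn_gt0.
    rewrite -(ltr_pM2l k0); apply: lt_le_trans (pow_lt _ kb) _.
    by rewrite mulrCA ler_wpM2l // -natrX -natrM ler_nat.
  apply: (@leq_trans (2 ^ (k * #|S|))); first by rewrite leq_exp2l.
  rewrite expnM leq_exp2r ?pow_le //.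
  (* Comparing powers with exponent [#|S|] requires [S] nonempty, which follows from [n > 0]. *)
  by case: #|S| nS => //; rewrite muln0 leqNgt (ltn_trans _ n3).
apply: contrapT => none; move/negP: bad; apply.
apply/andP; split; apply: min_colours_ge => // k c ck hc; rewrite leNgt;
  apply/negP => kb; apply: none; exists k.
  by have [S []] := closed_cf_sparse_class G c k grG ck hc; exists S.
by have [S []] := open_cf_sparse_class G c k grG ck hc; exists S.
Qed.

(** Put x = ln n and L = log2 n. Since L >= x >= 17, L^2 - 1 >= 17x - 1 >= 16x, so the left side is
    at most exp(2x - 4x) = n^(-2), which is below [harmonic n], that is 1/(n + 1). *)
Lemma union_bound_small (R : realType) (n : nat) : expR 17 <= n%:R :> R ->
  n%:R * (n%:R * expR (- (log2 (n%:R : R) ^+ 2 - 1) / 4)) <= harmonic n :> R.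
Proof.
move=> hn; have n0 : 0 < n%:R :> R by apply: lt_le_trans hn; exact: expR_gt0.
set x := ln (n%:R : R).
have nE : n%:R = expR x :> R by rewrite /x lnK.
have x17 : 17 <= x by rewrite -ler_expR -nE.
have l0 : 0 < ln 2 :> R by rewrite ln_gt0 ?ltr1n.
have l1 : ln 2 <= 1 :> R by have := @le_ln1Dx R 1; rewrite -[1 + 1]/2; apply; lra.
have xL : x <= log2 n%:R by rewrite /log2 -/x ler_pdivlMr // ler_piMr //; lra.
have n1 : 1 < n%:R :> R.
  by rewrite nE; apply: lt_le_trans (expR_ge1Dx x); lra.
apply: (@le_trans _ _ (expR (- 2%:R * x))).
  rewrite [X in X * _]nE [X in _ * (X * _)]nE -!expRD ler_expR; nra.
rewrite mulNr expRN expRM_natl -nE /harmonic /= lef_pV2 ?posrE ?exprn_gt0 //.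
have n2 : 2 <= n%:R :> R by move: n1; rewrite (ltr_nat _ 1) -(ler_nat R).
by rewrite -natr1; nra.
Qed.

Local Open Scope classical_set_scope.

Theorem mainTheorem12 (R : realType) (p : nat -> R)
  (hp01 : forall n, 0 <= p n <= 1)
  (hp : (fun n : nat => p n * n%:R / (log2 (n%:R : R)) ^+ 2) @ \oo --> +oo) :
  (fun n : nat =>
     Gnp_prob n (p n)
       (fun G => (log2 (p n * n%:R) - 2 * log2 (log2 (n%:R : R)) <= (chi_ccf G)%:R)
              && (log2 (p n * n%:R) - 2 * log2 (log2 (n%:R : R)) <= (chi_ocf G)%:R)))
    @ \oo --> (1 : R).
Proof.
apply: (@squeeze_cvgr _ _ _ _ (fun n => 2 - expR (harmonic n)) (fun=> 1)).
- near=> n; apply/andP; split; last exact: Gnp_prob_le1.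
  have n17 : expR 17 <= n%:R :> R by near: n; exact: nbhs_infty_ger.
  have n3 : (3 <= n)%N by near: n; exact: nbhs_infty_ge.
  (* Divergence excludes [p n = 0] for large [n], so inequalities on [log2 (p n * n%:R)] can be
     exponentiated. *)
  have pn0 : 0 < p n * n%:R.
    have : 0 < p n * n%:R / log2 (n%:R : R) ^+ 2 by near: n; exact: cvgry_gt.
    have [pn0|pnE] := eqVneq (p n * n%:R) 0; first by rewrite pn0 mul0r ltxx.
    by move=> _; rewrite lt0r pnE mulr_ge0 //; case/andP: (hp01 n).
  have L1 : 1 <= log2 (n%:R : R).
    have l0 : 0 < ln 2 :> R by rewrite ln_gt0 ?ltr1n.
    rewrite /log2 ler_pdivlMr // mul1r ler_ln ?posrE ?ltr0n ?ler_nat ?(ltn_trans _ n3) //.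
  apply: le_trans (@Gnp_prob_ge R n (p n) (log2 (n%:R : R) ^+ 2) _ _ _ _) => //.
  + by rewrite lerD2l lerN2 ler_expR union_bound_small.
  + by rewrite exprn_ge0 //; lra.
  + by move=> G grG; apply: few_colours_sparse_set.
- rewrite [X in _ --> X](_ : 1 = 2 - expR 0); last by rewrite expR0; lra.
  apply: cvgB; first exact: cvg_cst.
  apply: (@cvg_comp _ _ _ harmonic expR); first exact: cvg_harmonic.
  exact: continuous_expR.
- exact: cvg_cst.
Unshelve. all: by end_near.
Qed.
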